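(* Let $\mathcal{H}$ be a complex separable Hilbert space, let $\Phi=(\phi_n)_{n=1}^\infty$ and $\Psi=(\psi_n)_{n=1}^\infty$ be frames for $\mathcal{H}$, and let the complex sequence $m=(m_n)_{n=1}^\infty$ be semi-normalized. Assume that $M_{m,\Phi,\Psi}$ is invertible. If $\Psi$ is equivalent to $(m_n\phi_n)$ or $\Phi$ is equivalent to $(\overline{m}_n\psi_n)$, then $$M_{m,\Phi,\Psi}^{-1}=M_{1/m,\widetilde{\Psi},\widetilde{\Phi}}.$$
   Context: A sequence $\Phi=(\phi_n)_{n=1}^\infty$ in $\mathcal{H}$ is a frame for $\mathcal{H}$ if there are $0<A\le B<\infty$ with $A\|h\|^2\le\sum_n|\langle h,\phi_n\rangle|^2\le B\|h\|^2$ for all $h\in\mathcal{H}$. The frame operator is $S_\Phi h=\sum_n\langle h,\phi_n\rangle\phi_n$ and the canonical dual of $\Phi$ is $\widetilde{\Phi}=(S_\Phi^{-1}\phi_n)$. A complex sequence $m$ is semi-normalized if $0<\inf_n|m_n|\le\sup_n|m_n|<\infty$; $1/m=(1/m_n)$. Two frames $\Phi,\Psi$ for $\mathcal{H}$ are equivalent if there is an invertible operator $G:\mathcal{H}\to\mathcal{H}$ with $\psi_n=G\phi_n$ for all $n\in\mathbb{N}$. An operator $\mathcal{H}\to\mathcal{H}$ is invertible if it is a bounded bijection of $\mathcal{H}$ onto $\mathcal{H}$. For a complex sequence $m$ and sequences $\Phi,\Psi$ in $\mathcal{H}$, the multiplier is $M_{m,\Phi,\Psi}h=\sum_{n=1}^\infty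 m_n\langle h,\psi_n\rangle\phi_n$ (inner product linear in the first argument); it is well defined and bounded when $m\in\ell^\infty$ and $\Phi,\Psi$ are frames. *)

(* Defs.v *)
From HB Require Import structures.
From mathcomp Require Import all_boot all_order all_algebra.
From mathcomp Require Import all_classical all_reals all_analysis.
From mathcomp Require Import complex.

Set Implicit Arguments.
Unset Strict Implicit.
Unset Printing Implicit Defensive.

Import Order.TTheory GRing.Theory Num.Theory Num.Def.
Import numFieldNormedType.Exports.

Local Open Scope classical_set_scope.
Local Open Scope complex_scope.
Local Open Scope ring_scope.

(* Norms over R[i] take values in R[i]; rnorm is the same number as an element
   of R. *)
Definition rnorm (R : realType) (V : normedZmodType R[i]) (x : V) : R :=
  complex.Re `|x|.

Definition separable (T : topologicalType) : Prop :=
  exists2 D : set T, countable D & dense D.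

Definition semi_normalized (R : realType) (m : nat -> R[i]) : Prop :=
  (0 < ereal_inf (range (fun n => (rnorm (m n))%:E)))%E /\
  (ereal_sup (range (fun n => (rnorm (m n))%:E)) < +oo)%E.

Definition invertible_operator (R : realType) (H : normedModType R[i])
    (T : H -> H) : Prop :=
  [/\ linear T, exists K : R, forall x, rnorm (T x) <= K * rnorm x
    & bijective T].

(* The two-sided inverse of T when T is bijective (and 0 outside the range of
   T otherwise). *)
Definition opinv (R : realType) (H : normedModType R[i]) (T : H -> H) : H -> H :=
  'pinv_(fun=> 0) setT T.

Definition equivalent (R : realType) (H : normedModType R[i])
    (Phi Psi : nat -> H) : Prop :=
  exists2 G : H -> H, invertible_operator G & forall n, Psi n = G (Phi n).

(* An inner product is a {dot H for conjC}: linear in the first argument and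
   conjugate-linear in the second. *)
Definition frame (R : realType) (H : normedModType R[i])
    (ip : {dot H for conjC}) (Phi : nat -> H) : Prop :=
  exists A B : R, [/\ 0 < A, A <= B & forall h : H,
    ((A * rnorm h ^+ 2)%:E <= \sum_(0 <= n <oo) (rnorm (ip h (Phi n)) ^+ 2)%:E)%E /\
    (\sum_(0 <= n <oo) (rnorm (ip h (Phi n)) ^+ 2)%:E <= (B * rnorm h ^+ 2)%:E)%E].

Definition frame_operator (R : realType) (H : normedModType R[i])
    (ip : {dot H for conjC}) (Phi : nat -> H) (h : H) : H :=
  limn (series (fun n => ip h (Phi n) *: Phi n)).

Definition canonical_dual (R : realType) (H : normedModType R[i])
    (ip : {dot H for conjC}) (Phi : nat -> H) (n : nat) : H :=
  opinv (frame_operator ip Phi) (Phi n).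

Definition multiplier (R : realType) (H : normedModType R[i])
    (ip : {dot H for conjC}) (m : nat -> R[i]) (Phi Psi : nat -> H) (h : H) : H :=
  limn (series (fun n => (m n * ip h (Psi n)) *: Phi n)).

(* Main.v *)
(* Suppose [m_n Phi_n = G Psi_n]. Then [M = G S_Psi], while applying [G S_Psi]
   to the candidate inverse, whose range vectors are [S_Psi^-1 Psi_n], turns it
   into the reconstruction formula [S_Phi S_Phi^-1 = 1]. Suppose instead
   [m_n^* Psi_n = G Phi_n]. Then [M = S_Phi G^*], so the analysis coefficients
   of [M h] against the canonical dual of [Phi] are [<h, G Phi_n>], which is
   [m_n <h, Psi_n>], and the candidate sends [M h] to [S_Psi^-1 S_Psi h = h].
   A one-sided inverse suffices because [M] is assumed bijective, so [G] is only
   used as a bounded linear map and no open mapping theorem is needed. The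
   frame operator [S] is coercive, and [S x = y] is solved by the iteration
   [x := x + e (y - S x)], which contracts the residual for small [e > 0]. *)

Require Import Defs.
From HB Require Import structures.
From mathcomp Require Import all_boot all_order all_algebra.
From mathcomp Require Import all_classical all_reals all_analysis.
From mathcomp Require Import complex.
From mathcomp Require Import ring lra.

Set Implicit Arguments.
Unset Strict Implicit.
Unset Printing Implicit Defensive.

Import Order.TTheory GRing.Theory Num.Theory Num.Def.
Import numFieldNormedType.Exports.

Local Open Scope classical_set_scope.
Local Open Scope complex_scope.
Local Open Scope ring_scope.

(** * The real-valued norm *)

Section RealNorm.
Context {R : realType} {V : normedZmodType R[i]}.
Implicit Types x y : V.

(** A norm is nonnegative in [R[i]], which forces its imaginary part to vanish. *)
Lemma rnormE x : `|x| = (rnorm x)%:C.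
Proof.
have := normr_ge0 x; rewrite lecE /rnorm => /andP[/eqP h _].
by case: `|x| h => a b /= ->.
Qed.

Lemma rnorm_ge0 x : 0 <= rnorm x.
Proof. by rewrite -lecR -rnormE normr_ge0. Qed.

Lemma rnorm0 : rnorm (0 : V) = 0.
Proof. by rewrite /rnorm normr0. Qed.

Lemma rnorm_eq0 x : rnorm x = 0 -> x = 0.
Proof. by move=> x0; apply/eqP; rewrite -normr_eq0 rnormE x0. Qed.

Lemma rnormD x y : rnorm (x + y) <= rnorm x + rnorm y.
Proof. by rewrite -lecR rmorphD/= -!rnormE ler_normD. Qed.

Lemma rnormN x : rnorm (- x) = rnorm x.
Proof. by rewrite /rnorm normrN. Qed.

Lemma rnorm_sum (I : Type) (r : seq I) (F : I -> V) :
  rnorm (\sum_(i <- r) F i) <= \sum_(i <- r) rnorm (F i).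
Proof.
elim: r => [|i r IHr]; first by rewrite !big_nil rnorm0.
by rewrite !big_cons (le_trans (rnormD _ _))// lerD2l.
Qed.

End RealNorm.

Section RealNormScalar.
Context {R : realType}.
Implicit Types a b : R[i].

Lemma rnormZ (V : normedModType R[i]) a (x : V) :
  rnorm (a *: x) = rnorm a * rnorm x.
Proof. by apply: complexI; rewrite rmorphM/= -!rnormE normrZ. Qed.

Lemma rnormM a b : rnorm (a * b) = rnorm a * rnorm b.
Proof. by apply: complexI; rewrite rmorphM/= -!rnormE normrM. Qed.

Lemma rnormV a : rnorm a^-1 = (rnorm a)^-1.
Proof. by apply: complexI; rewrite fmorphV/= -!rnormE normfV. Qed.

Lemma rnorm_conj a : rnorm (a^*) = rnorm a.
Proof. by rewrite /rnorm norm_conjC. Qed.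

Lemma rnorm_real (r : R) : rnorm (r%:C) = `|r|.
Proof.
by apply: complexI; rewrite -rnormE normc_def/= expr0n addr0 sqrtr_sqr.
Qed.

End RealNormScalar.

(** * Convergence in the real-valued norm *)

Section Convergence.
Context {R : realType} {V : normedModType R[i]}.

(** A positive element of [R[i]] is real, so epsilon may range over [R] or over [R[i]] alike. *)
Lemma cvg_rnormP (u : nat -> V) (l : V) :
  u @ \oo --> l <->
  forall e : R, 0 < e -> \forall n \near \oo, rnorm (l - u n) < e.
Proof.
split=> [/cvgrPdist_lt ul e e0 | ul].
  have /ul : (0 < e%:C)%R by rewrite ltcR.
  by apply: filterS => n; rewrite rnormE ltcR.
apply/cvgrPdist_lt => -[a b]; rewrite ltcE/= => /andP[/eqP -> /ul].
by apply: filterS => n; rewrite rnormE complexr0 ltcR.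
Qed.

Lemma eq_cvg_series (u v : nat -> V) (l : V) :
  u =1 v -> series u @ \oo --> l -> series v @ \oo --> l.
Proof. by move=> /funext ->. Qed.

Lemma rnorm_cvg_le (u : nat -> V) (l : V) (K : R) :
  u @ \oo --> l -> (forall n, rnorm (u n) <= K) -> rnorm l <= K.
Proof.
move=> /cvg_rnormP ul uK; apply/ler_addgt0Pr => e /ul[n _ /(_ n (leqnn n)) lun].
rewrite -(subrK (u n) l) (le_trans (rnormD _ _))// addrC lerD//.
exact: ltW.
Qed.

End Convergence.

Section BoundedAdditive.
Context {R : realType} {V W : normedModType R[i]}.

(** Only compatibility with subtraction is asked of [T], so that both slots of an inner product
    qualify, the second being conjugate-linear. *)
Lemma cvg_bounded_additive (T : V -> W) (K : R)
    (u : nat -> V) (l : V) :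
  {morph T : x y / x - y} -> (forall x, rnorm (T x) <= K * rnorm x) ->
  u @ \oo --> l -> T \o u @ \oo --> T l.
Proof.
move=> TB TK /cvg_rnormP ul; apply/cvg_rnormP => e e0.
(* [K] may be zero or negative, while [|K| + 1] can be divided by. *)
have K0 : 0 < `|K| + 1 by rewrite ltr_wpDl.
have /ul : 0 < e / (`|K| + 1) by rewrite divr_gt0.
apply: filterS => n; rewrite ltr_pdivlMr// => lun /=; rewrite -TB.
apply: le_lt_trans lun; rewrite (le_trans (TK _))// mulrC ler_wpM2l ?rnorm_ge0//.
by rewrite (le_trans (ler_norm _))// lerDl.
Qed.

Lemma cvg_series_bounded_additive (T : V -> W) (K : R)
    (u : nat -> V) (l : V) :
  {morph T : x y / x - y} -> (forall x, rnorm (T x) <= K * rnorm x) ->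
  series u @ \oo --> l -> series (T \o u) @ \oo --> T l.
Proof.
move=> TB TK ul; have -> : series (T \o u) = T \o series u.
  have T0 : T 0 = 0 by rewrite -(subrr 0) TB subrr.
  have TD x y : T (x + y) = T x + T y.
    by rewrite -[y in LHS]opprK TB -[- y]add0r TB T0 add0r opprK.
  apply/funext => n; rewrite /series/=.
  by rewrite (big_morph T TD T0).
exact: cvg_bounded_additive TB TK ul.
Qed.

End BoundedAdditive.

(** Cauchy's criterion. The exponent will be 2 for series with square-summable coefficients and 1
    for geometrically decaying terms. *)
Lemma cvg_series_dominated {R : realType} {V : completeNormedModType R[i]}
    (u : nat -> V) (v : nat -> R) (K : R) (p : nat) :
  (forall m n, rnorm (\sum_(m <= k < n) u k) ^+ p.+1 <=
               K * \sum_(m <= k < n) v k) ->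
  cvgn (series v) -> cvgn (series u).
Proof.
move=> uv /cauchy_cvgP/cauchy_seriesP vc.
apply/cauchy_cvgP/cauchy_seriesP => -[e b]; rewrite ltcE/= => /andP[/eqP -> e0].
have K0 : 0 < `|K| + 1 by rewrite ltr_wpDl.
have /vc : 0 < e ^+ p.+1 / (`|K| + 1) by rewrite divr_gt0 ?exprn_gt0.
apply: filterS => -[m n] /=; rewrite ltr_pdivlMr// => h.
rewrite rnormE complexr0 ltcR -(ltr_pXn2r (ltn0Sn p)) ?nnegrE ?rnorm_ge0 ?ltW//.
apply: le_lt_trans h; rewrite (le_trans (uv m n))// (le_trans (ler_norm _))//.
by rewrite normrM mulrC ler_wpM2l// lerDl.
Qed.

Lemma cvg_series_bounded_mul {R : realType} (u v : nat -> R) (K : R) :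
  (forall n, 0 <= u n) -> (forall n, u n <= K * v n) ->
  (forall n, 0 <= v n) ->
  cvgn (series v) -> cvgn (series u).
Proof.
move=> u0 uv v0 vc.
apply: (@series_le_cvg _ _ (fun n => `|K| * v n)) => // [n|n|].
- by rewrite mulr_ge0.
- by rewrite (le_trans (uv n))// ler_wpM2r// ler_norm.
- exact: (is_cvg_seriesZ (V := R^o)).

Qed.

Section Opinv.
Context {R : realType} {H : normedModType R[i]} (T : H -> H).

Lemma opinvK : (forall y, exists x, T x = y) -> cancel (opinv T) T.
Proof.
move=> Tsurj y; apply: pinvK; rewrite inE.
by have [x <-] := Tsurj y; exists x.
Qed.

Lemma opinvKV : injective T -> cancel T (opinv T).
Proof.
by move=> Tinj x; apply: (pinvKV (fun=> 0)); rewrite ?inE// => a b _ _ /Tinj.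
Qed.

End Opinv.

(** * Inner products *)

Section InnerProduct.
Context {R : realType} {H : normedModType R[i]} (ip : {dot H for conjC}).
Hypothesis ip_norm : forall x : H, `|x| ^+ 2 = ip x x.
Implicit Types x y : H.

Lemma ip_conj x y : (ip x y)^* = ip y x.
Proof. by rewrite [RHS]hermC expr0 mul1r. Qed.

Lemma ipBl y : {morph ip^~ y : x z / x - z}.
Proof. by move=> x z; exact: linearBl. Qed.

Lemma ipBr y : {morph ip y : x z / x - z}.
Proof. by move=> x z; exact: raddfB. Qed.

Lemma ipZl a x y : ip (a *: x) y = a * ip x y.
Proof. exact: linearZl_LR. Qed.

Lemma ipZr a x y : ip x (a *: y) = a^* * ip x y.
Proof. exact: linearZr_LR. Qed.

Lemma ip_rnorm x : ip x x = (rnorm x ^+ 2)%:C.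
Proof. by rewrite -ip_norm rnormE rmorphXn. Qed.

Lemma CauchySchwarz_rnorm x y : rnorm (ip x y) <= rnorm x * rnorm y.
Proof.
have [y0|yN0] := eqVneq (rnorm y) 0.
  have -> : y = 0 by exact: rnorm_eq0.
  by rewrite (linear0r ip x) !rnorm0 mulr0.
have y2 : 0 < rnorm y ^+ 2 by rewrite exprn_gt0// lt_def yN0 rnorm_ge0.
rewrite -(ler_pXn2r (ltn0Sn 1)) ?nnegrE ?mulr_ge0 ?rnorm_ge0//.
(* The squared norm of this vector is [|y|^2 (|y|^2 |x|^2 - |ip x y|^2)], so the second factor is
   nonnegative. *)
have := ip_rnorm (ip y y *: x - ip x y *: y).
rewrite ipBl !ipBr !ipZl !ipZr !ip_conj.
have -> : ip y y * (ip y y * ip x x) - ip y y * (ip y x * ip x y)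
   - (ip x y * (ip y y * ip y x) - ip x y * (ip y x * ip y y))
   = ip y y * (ip y y * ip x x - ip x y * (ip x y)^*).
  by rewrite ip_conj; ring.
rewrite -normCK rnormE !ip_rnorm -!rmorphXn -!rmorphM -rmorphB -rmorphM/=.
move=> /complexI e.
have : 0 <= rnorm y ^+ 2 * rnorm x ^+ 2 - rnorm (ip x y) ^+ 2.
  by rewrite -(pmulr_rge0 _ y2) e sqr_ge0.
by rewrite subr_ge0 exprMn mulrC.
Qed.

Lemma rnormB_sqr x y :
  rnorm (x - y) ^+ 2 = rnorm x ^+ 2 + rnorm y ^+ 2 - 2 * complex.Re (ip x y).
Proof.
apply: complexI.
rewrite -ip_rnorm (dnormB ip) ip_conj -[ip y x]ip_conj.
rewrite !ip_rnorm addcJ [in RHS]mulr_natl mulr_natl.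
by rewrite [RHS]raddfB [X in _ = X - _]raddfD [X in _ = _ - X]raddfMn.
Qed.

Lemma cvg_series_ipl (u : nat -> H) (l y : H) :
  series u @ \oo --> l ->
  series (fun n => ip (u n) y : R[i]^o) @ \oo --> (ip l y : R[i]^o).
Proof.
apply: (@cvg_series_bounded_additive _ _ R[i]^o _ (rnorm y) _ _ (ipBl y)) => x.
by rewrite mulrC; exact: CauchySchwarz_rnorm.
Qed.

Lemma cvg_series_ipr (u : nat -> H) (l y : H) :
  series u @ \oo --> l ->
  series (fun n => ip y (u n) : R[i]^o) @ \oo --> (ip y l : R[i]^o).
Proof.
apply: (@cvg_series_bounded_additive _ _ R[i]^o _ (rnorm y) _ _ (ipBr y)) => x.
exact: CauchySchwarz_rnorm.
Qed.

End InnerProduct.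

(** * Bessel sequences and frame operators *)

Section Bessel.
Context {R : realType} {H : completeNormedModType R[i]}.
Variable ip : {dot H for conjC}.
Hypothesis ip_norm : forall x : H, `|x| ^+ 2 = ip x x.
Variables (Phi : nat -> H) (B : R).
Hypothesis B_gt0 : 0 < B.
Hypothesis Phi_bessel : forall (h : H) (m n : nat),
  \sum_(m <= k < n) rnorm (ip h (Phi k)) ^+ 2 <= B * rnorm h ^+ 2.

Local Notation S := (frame_operator ip Phi).

(* With [x] the sum on the left, expand [ip x x] in its first argument and use
   AM-GM in the form [2 |c d| <= B |c|^2 + |d|^2 / B]; the Bessel bound turns
   the terms in [d] into at most [|x|^2 / 2]. *)
Lemma bessel_synthesis_le (c : nat -> R[i]) (m n : nat) :
  rnorm (\sum_(m <= k < n) c k *: Phi k) ^+ 2 <=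
  B * \sum_(m <= k < n) rnorm (c k) ^+ 2.
Proof.
set x := \sum_(m <= k < n) c k *: Phi k.
have xE : (rnorm x ^+ 2)%:C = \sum_(m <= k < n) c k * ip (Phi k) x.
  rewrite -(ip_rnorm ip_norm) {1}/x.
  rewrite (big_morph (ip^~ x) (linearDl ip x) (linear0l ip x)).
  by apply: eq_bigr => k _; rewrite ipZl.
have -> : rnorm x ^+ 2 = rnorm ((rnorm x ^+ 2)%:C).
  by rewrite rnorm_real ger0_norm// sqr_ge0.
have le1 : rnorm ((rnorm x ^+ 2)%:C) <= \sum_(m <= k < n)
    (2^-1 * (B * rnorm (c k) ^+ 2) + 2^-1 * (B^-1 * rnorm (ip x (Phi k)) ^+ 2)).
  rewrite xE; apply: le_trans; first exact: rnorm_sum. apply: ler_sum => k _.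
  rewrite rnormM -[ip (Phi k) x]ip_conj rnorm_conj.
  set a := rnorm (c k); set b := rnorm (ip x (Phi k)).
  rewrite -subr_ge0.
  have -> : 2^-1 * (B * a ^+ 2) + 2^-1 * (B^-1 * b ^+ 2) - a * b =
            2^-1 * B^-1 * (B * a - b) ^+ 2.
    by field; rewrite gt_eqF.
  by rewrite mulr_ge0 ?sqr_ge0// mulr_ge0 ?invr_ge0 ?ltW.
have := Phi_bessel x m n; rewrite -(ler_pM2l (_ : 0 < B^-1)) ?invr_gt0//.
rewrite mulrA mulVf ?gt_eqF// mul1r => le2.
move: le1; rewrite big_split/= -!mulr_sumr rnorm_real ger0_norm ?sqr_ge0//.
move: le2; lra.
Qed.

Lemma bessel_synthesis_cvg (c : nat -> R[i]) :
  cvgn (series (fun n => rnorm (c n) ^+ 2)) ->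
  cvgn (series (fun n => c n *: Phi n)).
Proof. exact: (cvg_series_dominated (p := 1) (bessel_synthesis_le c)). Qed.

Lemma bessel_analysis_cvg (h : H) :
  cvgn (series (fun n => rnorm (ip h (Phi n)) ^+ 2)).
Proof.
apply: nondecreasing_is_cvgn.
  by apply: nondecreasing_series => n _ _; exact: sqr_ge0.
by exists (B * rnorm h ^+ 2) => _ [n _ <-]; exact: Phi_bessel.
Qed.

Lemma bessel_weighted_analysis_cvg (w : nat -> R[i]) (K : R) (h : H) :
  (forall n, rnorm (w n) <= K) ->
  cvgn (series (fun n => rnorm (w n * ip h (Phi n)) ^+ 2)).
Proof.
move=> wK; have le n :
    rnorm (w n * ip h (Phi n)) ^+ 2 <= K ^+ 2 * rnorm (ip h (Phi n)) ^+ 2.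
  rewrite rnormM exprMn ler_wpM2r ?sqr_ge0//.
  by rewrite lerXn2r ?nnegrE ?rnorm_ge0// (le_trans _ (wK n))// rnorm_ge0.
apply: (cvg_series_bounded_mul _ le _ (@bessel_analysis_cvg h)) => n;
  exact: sqr_ge0.
Qed.

Lemma frame_operator_cvg (h : H) :
  series (fun n => ip h (Phi n) *: Phi n) @ \oo --> S h.
Proof.
exact: (bessel_synthesis_cvg (c := fun n => ip h (Phi n))
  (@bessel_analysis_cvg h)).
Qed.

Lemma frame_operatorB : {morph S : x y / x - y}.
Proof.
move=> x y; apply: cvg_lim => //.
rewrite [X in X @ _](_ : _ = series (fun n => ip x (Phi n) *: Phi n) -
                             series (fun n => ip y (Phi n) *: Phi n)).
  exact: cvgB (@frame_operator_cvg x) (@frame_operator_cvg y).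
apply/funext => n; rewrite /series/= fctE -sumrB.
by apply: eq_bigr => k _; rewrite ipBl scalerBl.
Qed.

Lemma frame_operatorZ (a : R[i]) (x : H) : S (a *: x) = a *: S x.
Proof.
apply: cvg_lim => //.
rewrite [X in X @ _](_ : _ = a *: series (fun n => ip x (Phi n) *: Phi n)).
  exact: cvgZl_tmp (@frame_operator_cvg x).
apply/funext => n; rewrite /series/= fctE scaler_sumr.
by apply: eq_bigr => k _; rewrite ipZl scalerA.
Qed.

(** The partial sums obey the bound: in the squared norm, the synthesis and the Bessel inequality
    contribute one factor [B] each. *)
Lemma frame_operator_le (h : H) : rnorm (S h) <= B * rnorm h.
Proof.
apply: rnorm_cvg_le (@frame_operator_cvg h) _ => n.
rewrite -(ler_pXn2r (ltn0Sn 1)) ?nnegrE ?mulr_ge0 ?rnorm_ge0 ?(ltW B_gt0)//.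
rewrite (le_trans (bessel_synthesis_le _ 0 n))//.
by rewrite exprMn (expr2 B) -mulrA ler_pM2l.
Qed.

Lemma frame_operator_sym (x y : H) : ip (S x) y = ip x (S y).
Proof.
have := cvg_series_ipl ip_norm (y := y) (@frame_operator_cvg x).
have := cvg_series_ipr ip_norm (y := x) (@frame_operator_cvg y).
have -> : (fun n => ip x (ip y (Phi n) *: Phi n) : R[i]^o) =
          (fun n => ip (ip x (Phi n) *: Phi n) y : R[i]^o).
  by apply/funext => n; rewrite ipZl ipZr ip_conj mulrC.
by move=> h1 h2; apply: cvg_unique h2 h1.
Qed.

End Bessel.

(** Turns the upper frame bound, an inequality between extended reals, into one on finite blocks of
    terms, the form that suits Cauchy's criterion. *)
Lemma frame_bessel {R : realType} {H : normedModType R[i]}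
    (ip : {dot H for conjC}) (Phi : nat -> H) :
  frame ip Phi -> exists B : R, 0 < B /\ forall (h : H) (m n : nat),
    \sum_(m <= k < n) rnorm (ip h (Phi k)) ^+ 2 <= B * rnorm h ^+ 2.
Proof.
move=> [A [B [A0 AB fr]]]; exists B; split; first exact: lt_le_trans A0 AB.
move=> h m n; rewrite -lee_fin; apply: le_trans (fr h).2.
apply: le_trans (nneseries_lim_ge n _); last by move=> *; rewrite lee_fin sqr_ge0.
rewrite sumEFin lee_fin.
have [mn|nm] := leqP m n; last first.
  by rewrite [leLHS]big_geq ?(ltnW nm)// sumr_ge0// => *; exact: sqr_ge0.
rewrite [leRHS](@big_cat_nat _ _ _ m)//= lerDr sumr_ge0// => *.
exact: sqr_ge0.
Qed.

(** * Invertibility of the frame operator *)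

Section FrameOperator.
Context {R : realType} {H : completeNormedModType R[i]}.
Variable ip : {dot H for conjC}.
Hypothesis ip_norm : forall x : H, `|x| ^+ 2 = ip x x.
Variable Phi : nat -> H.
Hypothesis Phi_frame : frame ip Phi.

Local Notation S := (frame_operator ip Phi).
Local Notation T := (opinv S).

(** [ip h (S h)] is the sum of the [|ip h (Phi n)|^2], which the lower frame bound controls. *)
Lemma frame_operator_coercive : exists2 A : R, 0 < A &
  forall h, A * rnorm h ^+ 2 <= complex.Re (ip h (S h)).
Proof.
have [B [B0 bes]] := frame_bessel Phi_frame.
have [A [B' [A0 _ fr]]] := Phi_frame; exists A => // h.
have := (fr h).1.
have sc := bessel_analysis_cvg bes (h := h).
set v := (fun n => rnorm (ip h (Phi n)) ^+ 2) in sc *.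
have -> : (\sum_(0 <= n <oo) (v n)%:E)%E = (limn (series v))%:E.
  rewrite -EFin_lim// (_ : EFin \o _ = fun n => (\sum_(0 <= k < n) (v k)%:E)%E)//.
  by apply/funext => n /=; rewrite sumEFin.
rewrite lee_fin => A_le; apply: le_trans A_le _.
(* The series for [ip h (S h)] has the same partial sums as [v], and taking real parts does not
   increase distances. *)
suff vRe : series v @ \oo --> complex.Re (ip h (S h)) by rewrite (cvg_lim _ vRe).
apply/cvgrPdist_lt => e e0.
have /cvg_rnormP/(_ e e0) := cvg_series_ipr ip_norm (y := h)
  (frame_operator_cvg ip_norm B0 bes (h := h)).
apply: filterS => n; apply: le_lt_trans.
have -> : series (fun n => ip h (ip h (Phi n) *: Phi n) : R[i]^o) n =
    (series v n)%:C.
  rewrite /series/= rmorph_sum; apply: eq_bigr => k _.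
  by rewrite ipZr mulrC -normCK rnormE rmorphXn.
by rewrite -lecR -rnormE (le_trans _ (normc_ge_Re _))// raddfB.
Qed.

Lemma frame_operator_contraction : exists e q : R, [/\ 0 < e, 0 <= q, q < 1 &
  forall h, rnorm (h - e%:C *: S h) <= q * rnorm h].
Proof.
have [B [B0 bes]] := frame_bessel Phi_frame.
have [A A0 coer] := frame_operator_coercive.
have D0 : 0 < A ^+ 2 + B ^+ 2 by rewrite addr_gt0 ?exprn_gt0.
set D := A ^+ 2 + B ^+ 2 in D0.
(* Expanding the square bounds the squared factor by [1 - 2 e A + e^2 B^2]. At [e = A / D] this is
   at most [1 - A^2 / D = B^2 / D], which lies below 1 however [A] and [B] compare. *)
exists (A / D), (Num.sqrt (B ^+ 2 / D)); split.
- by rewrite divr_gt0.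
- exact: sqrtr_ge0.
- rewrite -[ltRHS]sqrtr1 ltr_sqrt// ltr_pdivrMr// mul1r ltrDr.
  by rewrite exprn_gt0.
move=> h; rewrite -(ler_pXn2r (ltn0Sn 1)) ?nnegrE ?mulr_ge0 ?rnorm_ge0 ?sqrtr_ge0//.
rewrite exprMn sqr_sqrtr ?divr_ge0 ?sqr_ge0// ?(ltW D0)//.
rewrite (rnormB_sqr ip_norm) rnormZ exprMn rnorm_real.
rewrite ger0_norm ?divr_ge0 ?(ltW A0) ?(ltW D0)//.
have -> : complex.Re (ip h ((A / D)%:C *: S h)) = A / D * complex.Re (ip h (S h)).
  rewrite ipZr; case: (ip h (S h)) => a b.
  have -> : ((A / D)%:C)^* = (A / D)%:C.
    by rewrite conj_Creal// realE lecE/= eqxx divr_ge0// ltW.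
  by rewrite /= mul0r subr0.
have Sh : rnorm (S h) ^+ 2 <= B ^+ 2 * rnorm h ^+ 2.
  rewrite -exprMn lerXn2r ?nnegrE ?mulr_ge0 ?rnorm_ge0 ?(ltW B0)//.
  exact: (frame_operator_le ip_norm B0 bes).
have le1 : (A / D) ^+ 2 * rnorm (S h) ^+ 2 <=
    (A / D) ^+ 2 * (B ^+ 2 * rnorm h ^+ 2) by rewrite ler_wpM2l ?sqr_ge0.
have le2 : A / D * (A * rnorm h ^+ 2) <= A / D * complex.Re (ip h (S h)).
  by rewrite ler_wpM2l// divr_ge0// ltW.
(* The last summand is the nonnegative slack between [q^2] and the quadratic bound. *)
have -> : B ^+ 2 / D * rnorm h ^+ 2 = rnorm h ^+ 2
    + (A / D) ^+ 2 * (B ^+ 2 * rnorm h ^+ 2) - 2 * (A / D * (A * rnorm h ^+ 2))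
    + (A / D) ^+ 2 * (A ^+ 2 * rnorm h ^+ 2).
  by rewrite /D; field; rewrite lt0r_neq0.
have : 0 <= (A / D) ^+ 2 * (A ^+ 2 * rnorm h ^+ 2).
  by rewrite -!exprMn sqr_ge0.
move: le1 le2; lra.
Qed.

Lemma frame_operator_surj y : exists x, S x = y.
Proof.
have [B [B0 bes]] := frame_bessel Phi_frame.
have [e [q [e0 q0 q1 ctr]]] := frame_operator_contraction.
(* [r k] is the residual after [k] steps of the iteration started at 0, whose increments are
   [e r k]. *)
pose r k := iter k (fun h => h - e%:C *: S h) y.
have rq k : rnorm (r k) <= q ^+ k * rnorm y.
  elim: k => [|k IH]; first by rewrite expr0 mul1r.
  by rewrite (le_trans (ctr _))// exprS -mulrA ler_wpM2l.
have geo : cvgn (series (geometric 1 q)).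
  by apply: is_cvg_geometric_series; rewrite ger0_norm.
have xc : cvgn (series (fun k => e%:C *: r k)).
  apply: (cvg_series_dominated (p := 0) (K := e * rnorm y) _ geo) => m n.
  rewrite expr1; apply: (le_trans (rnorm_sum _ _)).
  rewrite mulr_sumr ler_sum// => k _.
  rewrite rnormZ rnorm_real (gtr0_norm e0) -mulrA ler_pM2l// mulrC.
  by rewrite /geometric/= mul1r.
exists (limn (series (fun k => e%:C *: r k))).
have Sc := cvg_series_bounded_additive (frame_operatorB ip_norm B0 bes)
  (frame_operator_le ip_norm B0 bes) xc.
apply: cvg_unique Sc _ => //.
(* Telescoping: [e S (r k) = r k - r (k+1)] and [r 0 = y]. *)
have -> : series (S \o (fun k => e%:C *: r k)) = (fun n => y - r n).
  apply/funext => n; rewrite /series/=; elim: n => [|n IH].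
    by rewrite big_geq// subrr.
  rewrite big_nat_recr//= IH (frame_operatorZ ip_norm B0 bes).
  by rewrite opprB addrAC addrA.
suff r0 : r @ \oo --> 0.
  by have := cvgB (cvg_cst y) r0; rewrite subr0; exact.
apply/cvg_rnormP => d d0.
have y0 : 0 < rnorm y + 1 by rewrite ltr_wpDl ?rnorm_ge0.
have /cvgrPdist_lt/(_ (d / (rnorm y + 1))) : q ^+ n @[n --> \oo] --> 0.
  by apply: cvg_expr; rewrite ger0_norm.
rewrite divr_gt0// => /(_ isT); apply: filterS => n.
rewrite !sub0r rnormN normrN ger0_norm ?exprn_ge0// ltr_pdivlMr//.
apply: le_lt_trans; rewrite (le_trans (rq n))// ler_wpM2l ?exprn_ge0//.
by rewrite lerDl.
Qed.

(** Divide [A |h|^2 <= Re (ip h (S h)) <= |h| |S h|] by [|h|]. This yields both the injectivity of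
    [S] and the boundedness of its inverse. *)
Lemma frame_operator_bounded_below :
  exists K : R, forall h, rnorm h <= K * rnorm (S h).
Proof.
have [A A0 coer] := frame_operator_coercive; exists A^-1 => h.
have [h0|hN0] := eqVneq (rnorm h) 0.
  by rewrite h0 mulr_ge0 ?rnorm_ge0// invr_ge0 ltW.
have h_gt0 : 0 < rnorm h by rewrite lt_def hN0 rnorm_ge0.
rewrite ler_pdivlMl// -(ler_pM2r h_gt0) -mulrA -expr2.
rewrite (le_trans (coer h))// mulrC.
rewrite (le_trans _ (CauchySchwarz_rnorm ip_norm _ _))//.
rewrite (le_trans (ler_norm _))// -lecR -rnormE; exact: normc_ge_Re.
Qed.

Lemma frame_operator_inj : injective S.
Proof.
have [B [B0 bes]] := frame_bessel Phi_frame.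
have [K below] := frame_operator_bounded_below => x y Sxy.
apply/eqP; rewrite -subr_eq0; apply/eqP/rnorm_eq0/le_anti.
have := below (x - y); rewrite (frame_operatorB ip_norm B0 bes) Sxy subrr.
by rewrite rnorm0 mulr0 => ->; rewrite rnorm_ge0.
Qed.

Lemma frame_operator_opinvK : cancel T S.
Proof. exact/opinvK/frame_operator_surj. Qed.

Lemma frame_operator_opinvKV : cancel S T.
Proof. exact/opinvKV/frame_operator_inj. Qed.

Lemma frame_operator_opinvB : {morph T : x y / x - y}.
Proof.
have [B [B0 bes]] := frame_bessel Phi_frame => x y.
apply: frame_operator_inj.
by rewrite (frame_operatorB ip_norm B0 bes) !frame_operator_opinvK.
Qed.

Lemma frame_operator_opinvZ a x : T (a *: x) = a *: T x.
Proof.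
have [B [B0 bes]] := frame_bessel Phi_frame.
apply: frame_operator_inj.
by rewrite (frame_operatorZ ip_norm B0 bes) !frame_operator_opinvK.
Qed.

Lemma frame_operator_opinv_le :
  exists K : R, forall h, rnorm (T h) <= K * rnorm h.
Proof.
have [K below] := frame_operator_bounded_below; exists K => h.
by have := below (T h); rewrite frame_operator_opinvK.
Qed.

Lemma frame_operator_opinv_sym x y : ip (T x) y = ip x (T y).
Proof.
have [B [B0 bes]] := frame_bessel Phi_frame.
rewrite -[y in LHS]frame_operator_opinvK.
by rewrite -(frame_operator_sym ip_norm B0 bes) frame_operator_opinvK.
Qed.

Lemma canonical_dualK n : S (canonical_dual ip Phi n) = Phi n.
Proof. exact: frame_operator_opinvK. Qed.

Lemma ip_canonical_dual h n : ip h (canonical_dual ip Phi n) = ip (T h) (Phi n).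
Proof. by rewrite frame_operator_opinv_sym. Qed.

End FrameOperator.

(** * Multipliers *)

Lemma semi_normalized_bounds {R : realType} (m : nat -> R[i]) :
  semi_normalized m -> exists K L : R, [/\ forall n, m n != 0,
    forall n, rnorm (m n) <= K & forall n, rnorm (m n)^-1 <= L].
Proof.
move=> [inf_gt0 sup_lt].
have infm n : (ereal_inf (range (fun n => (rnorm (m n))%:E)) <= (rnorm (m n))%:E)%E.
  by apply: ereal_inf_lbound; exists n.
have supm n : ((rnorm (m n))%:E <= ereal_sup (range (fun n => (rnorm (m n))%:E)))%E.
  by apply: ereal_sup_ubound; exists n.
(* The infimum cannot be [+oo], nor the supremum [-oo], because the term of index 0 is finite. *)
case: ereal_inf inf_gt0 infm => [a|_ /(_ 0%N)|] //= a0 am.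
case: ereal_sup sup_lt supm => [b|//|_ /(_ 0%N)] //= _ mb.
rewrite lte_fin in a0.
have m_gt0 n : 0 < rnorm (m n) by rewrite (lt_le_trans a0)// -lee_fin.
exists b, a^-1; split=> n.
- by apply/eqP => mn0; have := m_gt0 n; rewrite mn0 rnorm0 ltxx.
- by rewrite -lee_fin.
- by rewrite rnormV lef_pV2 ?posrE// -lee_fin.
Qed.

Section Multiplier.
Context {R : realType} {H : completeNormedModType R[i]}.
Variable ip : {dot H for conjC}.
Hypothesis ip_norm : forall x : H, `|x| ^+ 2 = ip x x.
Variables Phi Psi : nat -> H.
Hypotheses (Phi_frame : frame ip Phi) (Psi_frame : frame ip Psi).

(** Bounded weights keep the analysis coefficients square-summable, so that Bessel synthesis
    converges. *)
Lemma multiplier_cvg (w : nat -> R[i]) (K : R) (h : H) :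
  (forall n, rnorm (w n) <= K) ->
  series (fun n => (w n * ip h (Psi n)) *: Phi n) @ \oo -->
    multiplier ip w Phi Psi h.
Proof.
have [B [B0 bPhi]] := frame_bessel Phi_frame.
have [C [C0 bPsi]] := frame_bessel Psi_frame.
move=> wK; apply: (bessel_synthesis_cvg ip_norm B0 bPhi (c := fun n => w n * _)).
exact: (bessel_weighted_analysis_cvg bPsi (h := h) wK).
Qed.

(** The inverse of [S_Phi] leaves the series because it is linear and bounded; that of [S_Psi] moves
    onto [h] because it is self-adjoint. *)
Lemma multiplier_canonical_dual (w : nat -> R[i]) (K : R) (h : H) :
  (forall n, rnorm (w n) <= K) ->
  multiplier ip w (canonical_dual ip Phi) (canonical_dual ip Psi) h =
  opinv (frame_operator ip Phi)
    (multiplier ip w Phi Psi (opinv (frame_operator ip Psi) h)).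
Proof.
move=> wK; apply: cvg_lim => //.
have [L TL] := frame_operator_opinv_le ip_norm Phi_frame.
apply: (eq_cvg_series _ (cvg_series_bounded_additive
  (frame_operator_opinvB ip_norm Phi_frame) TL
  (multiplier_cvg (h := opinv (frame_operator ip Psi) h) wK))) => n /=.
by rewrite frame_operator_opinvZ// ip_canonical_dual.
Qed.

End Multiplier.

(** * Multipliers under an equivalence of frames *)

Section EquivalentFrames.
Context {R : realType} {H : completeNormedModType R[i]}.
Variable ip : {dot H for conjC}.
Hypothesis ip_norm : forall x : H, `|x| ^+ 2 = ip x x.
Variables (Phi Psi : nat -> H) (m : nat -> R[i]).
Hypotheses (Phi_frame : frame ip Phi) (Psi_frame : frame ip Psi).
Hypothesis m_sn : semi_normalized m.
Variables (G : H -> H) (K : R).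
Hypothesis G_linear : linear G.
Hypothesis G_bounded : forall x, rnorm (G x) <= K * rnorm x.

Local Notation M := (multiplier ip m Phi Psi).
Local Notation M' := (multiplier ip (fun n => (m n)^-1)
  (canonical_dual ip Psi) (canonical_dual ip Phi)).

Let GB : {morph G : x y / x - y}.
Proof. by move=> x y; rewrite -scaleN1r addrC G_linear scaleN1r addrC. Qed.

Let GZ a x : G (a *: x) = a *: G x.
Proof.
have G0 : G 0 = 0 by rewrite -[X in G X](subrr 0) GB subrr.
by have := G_linear a x 0; rewrite G0 !addr0.
Qed.

(* Here [M = G S_Psi] and [M' = S_Psi^-1 G^-1]. *)
Lemma multiplier_rightK : (forall n, m n *: Phi n = G (Psi n)) -> cancel M' M.
Proof.
move=> GPsi h.
have [C [L [mN0 mC mL]]] := semi_normalized_bounds m_sn.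
have ME x : M x = G (frame_operator ip Psi x).
  have [B [B0 bes]] := frame_bessel Psi_frame.
  apply: cvg_lim => //.
  apply: (eq_cvg_series _ (cvg_series_bounded_additive GB G_bounded
    (frame_operator_cvg ip_norm B0 bes (h := x)))) => n /=.
  by rewrite GZ -GPsi scalerA mulrC.
rewrite ME (multiplier_canonical_dual ip_norm _ _ _ mL)//.
rewrite frame_operator_opinvK//.
rewrite -[RHS](frame_operator_opinvK ip_norm Phi_frame).
(* [G] sends the term [(m n)^-1 ip k (Phi n) Psi n] to [ip k (Phi n) Phi n], so the image series is
   the one defining [S_Phi k]. *)
set k := opinv _ h.
apply/esym/cvg_lim => //.
apply: (eq_cvg_series _ (cvg_series_bounded_additive GB G_bounded
    (multiplier_cvg ip_norm Psi_frame Phi_frame (h := k) mL))) => n /=.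
by rewrite GZ -GPsi scalerA mulrAC mulVf ?mul1r.
Qed.

(* Here [M = S_Phi G^*]; expanding [G Phi_n] through [S_Phi] gives
   [<M h, S_Phi^-1 Phi_n> = <h, G Phi_n> = m_n <h, Psi_n>] without mentioning
   the adjoint. *)
Lemma multiplier_leftK :
  (forall n, (m n)^* *: Psi n = G (Phi n)) -> cancel M M'.
Proof.
move=> GPhi h.
have [C [L [mN0 mC mL]]] := semi_normalized_bounds m_sn.
have [B [B0 bes]] := frame_bessel Phi_frame.
have ipM n : ip (M h) (canonical_dual ip Phi n) = m n * ip h (Psi n).
  have -> : m n * ip h (Psi n) = ip h (G (Phi n)).
    by rewrite -GPhi ipZr conjCK.
  rewrite -[in RHS](canonical_dualK ip_norm Phi_frame).
  (* Expanding [M h] on the left and [G (S_Phi d)] on the right gives the same terms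
     [m k * ip h (Psi k) * ip (Phi k) d], as the second slot turns the conjugate weights back into
     [m k]. *)
  set d := canonical_dual ip Phi n.
  have h1 := cvg_series_ipl ip_norm (y := d)
    (multiplier_cvg ip_norm Phi_frame Psi_frame (h := h) mC).
  have h2 := cvg_series_ipr ip_norm (y := h)
    (cvg_series_bounded_additive GB G_bounded
      (frame_operator_cvg ip_norm B0 bes (h := d))).
  apply: cvg_unique h1 _ => //; apply: eq_cvg_series h2 => k /=.
  by rewrite GZ -GPhi ipZr ipZr ipZl conjCK ip_conj mulrC.
rewrite (multiplier_canonical_dual ip_norm _ _ _ mL)//.
(* Both sides become [S_Psi^-1] of a series, and the series agree termwise once [(m n)^-1] cancels
   the weight in [ipM]. *)
rewrite -[RHS](frame_operator_opinvKV ip_norm Psi_frame); congr opinv.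
rewrite /multiplier /frame_operator; congr (limn (series _)).
apply/funext => n.
by rewrite -ip_canonical_dual// ipM mulrA mulVf ?mul1r.
Qed.

End EquivalentFrames.

Theorem proposition4p7 (R : realType) (H : completeNormedModType R[i])
    (ip : {dot H for conjC})
    (ip_norm : forall x : H, `|x| ^+ 2 = ip x x)
    (H_separable : separable H)
    (Phi Psi : nat -> H) (m : nat -> R[i])
    (Phi_frame : frame ip Phi) (Psi_frame : frame ip Psi)
    (m_sn : semi_normalized m)
    (M_inv : invertible_operator (multiplier ip m Phi Psi))
    (equiv : equivalent Psi (fun n => m n *: Phi n) \/
             equivalent Phi (fun n => (m n)^* *: Psi n)) :
  opinv (multiplier ip m Phi Psi) =
  multiplier ip (fun n => (m n)^-1)
    (canonical_dual ip Psi) (canonical_dual ip Phi).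
Proof.
case: M_inv => _ _ Mbij; apply/funext => h.
case: equiv => -[G [G_linear [K G_bounded] _] GE].
(* A right inverse: write [h] as [M (M' h)] and cancel [M] by injectivity. *)
- rewrite -{1}(multiplier_rightK ip_norm Phi_frame Psi_frame m_sn
    G_linear G_bounded GE h).
  exact/opinvKV/bij_inj.
(* A left inverse: surjectivity writes [h] as [M (g h)], and both sides then reduce to [g h]. *)
- have [g _ gK] := Mbij.
  rewrite -{1 2}(gK h) (multiplier_leftK ip_norm Phi_frame Psi_frame m_sn
    G_linear G_bounded GE).
  exact/opinvKV/bij_inj.
Qed.
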